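(* Let $n\ge 1$ and $r\geq 2$ be integers. For any hypergraph $\mathcal{F}\subseteq 2^{[n]}$ on the vertex set $[n]$, we have $$\chi(\mathrm{KG}^r(\mathcal{F}))\geq \frac{n-alt_r(\mathcal{F})}{r-1}.$$
   Context: $[n]=\{1,\ldots,n\}$. A hypergraph $\mathcal{F}\subseteq 2^{[n]}$ is a family of distinct non-empty subsets (edges) of the vertex set $[n]$. A $t$-coloring of a hypergraph is a map from its vertices to $\{1,\ldots,t\}$ such that no edge is monochromatic; the chromatic number $\chi$ is the least $t$ for which a $t$-coloring exists (so it is $0$ if and only if there are no vertices). The Kneser hypergraph $\mathrm{KG}^r(\mathcal{F})$ has the edges of $\mathcal{F}$ as its vertices, and its edges are all $r$-element collections of pairwise disjoint edges of $\mathcal{F}$. Let $\mathcal{Z}_r=\{\omega_1,\ldots,\omega_r\}$ be a set of $r$ distinct symbols, none equal to $0$. A non-zero $X=(x_1,\ldots,x_n)\in(\mathcal{Z}_r\cup\{0\})^n$ is identified with the tuple $(X^1,\ldots,X^r)$ of pairwise disjoint sets $X^j=\{i\in[n]: x_i=\omega_j\}$. For such $X$, $alt(X)$ is the maximum length of a subsequence of non-zero terms of $x_1,\ldots,x_n$ in which any two consecutive terms are different. For a permutation $\sigma$ of $[n]$, $alt_\sigma(X)=alt(x_{\sigma(1)},\ldots,x_{\sigma(n)})$. $alt_{r,\sigma}(\mathcal{F})$ is the largest integer $k$ for which there is a non-zero $X\in(\mathcal{Z}_r\cup\{0\})^n$ with $alt_\sigma(X)=k$ such that none of $X^1,\ldots,X^r$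 contains a member of $\mathcal{F}$ (and it is $0$ if no such $X$ exists). Finally $alt_r(\mathcal{F})=\min\{alt_{r,\sigma}(\mathcal{F}):\sigma\in S_n\}$. *)

(* Defs.v *)
From mathcomp Require Import all_boot all_order all_algebra all_fingroup.

Set Implicit Arguments.
Unset Strict Implicit.
Unset Printing Implicit Defensive.

(* A hypergraph is given by its finite vertex type [V] and its edge set
   [E : {set {set V}}]; in particular the hypergraphs on [n] are the
   [F : {set {set 'I_n}}] with [set0 \notin F]. *)

Definition monochromatic (V : finType) (t : nat) (f : {ffun V -> 'I_t})
    (e : {set V}) : bool :=
  [forall u in e, forall v in e, f u == f v].

Definition is_coloring (V : finType) (E : {set {set V}}) (t : nat)
    (f : {ffun V -> 'I_t}) : bool :=
  [forall e in E, ~~ monochromatic f e].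

Definition colorable (V : finType) (E : {set {set V}}) (t : nat) : bool :=
  [exists f : {ffun V -> 'I_t}, is_coloring E f].

(* A colorable hypergraph is #|V|-colorable, so the search below finds the least
   number of colors (chromatic_number_colorable, chromatic_number_min).  The
   value for hypergraphs with no coloring at all (those with an edge of size
   at most 1) is the junk value #|V|.+1; it does not occur for Kneser
   hypergraphs with 1 < r (Kneser_colorable). *)
Definition chromatic_number (V : finType) (E : {set {set V}}) : nat :=
  find (colorable E) (iota 0 #|V|.+1).

Lemma colorable_card (V : finType) (E : {set {set V}}) t :
  colorable E t -> colorable E #|V|.
Proof.
move=> /existsP[f /forall_inP fE]; apply/existsP.
exists [ffun v => enum_rank v]; apply/forall_inP => e /fE; apply: contra.
move=> /forall_inP mono; apply/forall_inP => u ue; apply/forall_inP => v ve.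
have /forall_inP/(_ v ve) := mono u ue.
by rewrite !ffunE => /eqP/enum_rank_inj ->.
Qed.

Lemma chromatic_number_colorable (V : finType) (E : {set {set V}}) t :
  colorable E t -> colorable E (chromatic_number E).
Proof.
move=> /colorable_card Ec.
have Eh : has (colorable E) (iota 0 #|V|.+1).
  by apply/hasP; exists #|V| => //; rewrite mem_iota add0n leqnn.
have := nth_find 0 Eh; rewrite nth_iota ?add0n //.
by move: Eh; rewrite has_find size_iota.
Qed.

Lemma chromatic_number_min (V : finType) (E : {set {set V}}) t :
  colorable E t -> chromatic_number E <= t.
Proof.
move=> Et; rewrite leqNgt; apply/negP => lt_t.
have := before_find 0 lt_t; rewrite nth_iota ?add0n ?Et //.
by apply: leq_trans lt_t _; rewrite -[leqRHS](size_iota 0) find_size.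
Qed.

Definition Kneser_vertex (n : nat) (F : {set {set 'I_n}}) : finType :=
  {A : {set 'I_n} | A \in F}.

Definition Kneser (r n : nat) (F : {set {set 'I_n}}) :
    {set {set Kneser_vertex F}} :=
  [set e : {set Kneser_vertex F} | (#|e| == r) &&
    [forall A in e, forall B in e, (A != B) ==> [disjoint val A & val B]]].

Lemma Kneser_colorable (r n : nat) (F : {set {set 'I_n}}) :
  1 < r -> colorable (Kneser r F) #|Kneser_vertex F|.
Proof.
move=> r_gt1; apply/existsP; exists [ffun v => enum_rank v].
apply/forall_inP => e; rewrite inE => /andP[/eqP er _].
have /card_gt1P[u [v [ue ve uv]]] : 1 < #|e| by rewrite er.
apply/negP => /forall_inP/(_ u ue)/forall_inP/(_ v ve).
by rewrite !ffunE (inj_eq enum_rank_inj) (negPf uv).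
Qed.

(* The symbols omega_1, ..., omega_r are the [Some j] with [j : 'I_r], and the
   symbol 0 is [None]. *)
Definition signvec (r n : nat) : finType := {ffun 'I_n -> option 'I_r}.

Definition part (r n : nat) (X : signvec r n) (j : 'I_r) : {set 'I_n} :=
  [set i | X i == Some j].

Definition alternating (T : eqType) (s : seq (option T)) : bool :=
  all isSome s && sorted (fun x y => x != y) s.

(* Subsequences of [s] are enumerated by the boolean masks selecting them. *)
Definition alt_seq (T : eqType) (s : seq (option T)) : nat :=
  \max_(m : (size s).-tuple bool | alternating (mask m s)) size (mask m s).

Definition alt (r n : nat) (s : 'S_n) (X : signvec r n) : nat :=
  alt_seq [seq X (s i) | i <- enum 'I_n].

Definition alt_perm (r n : nat) (s : 'S_n) (F : {set {set 'I_n}}) : nat :=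
  \max_(X : signvec r n | (X != [ffun => None]) &&
      [forall j, forall A in F, ~~ (A \subset part X j)]) alt s X.

Definition alt_min (r n : nat) (F : {set {set 'I_n}}) : nat :=
  alt_perm r [arg min_(s < (1%g : 'S_n)) alt_perm r s F] F.

(* Main.v *)
Require Import Defs.
From mathcomp Require Import all_boot all_order all_algebra all_fingroup.
From mathcomp Require Import ring zify.
Import Order.TTheory GRing.Theory Num.Theory.

(** For a permutation s of the vertices and a proper colouring of the Kneser
    hypergraph with t colours, the claim is n <= alt + t (r - 1), where alt is
    the largest alternation number of a sign vector none of whose letter sets
    contains a member of F; such a vector is said to avoid F.

    Let first r be prime, so that the signs form the field Z/r, which acts on
    sign vectors by adding a constant to all the signs.  To a sign vector X
    belongs the set L(X) of all pairs (j, c) such that the set of places where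
    X has the sign j contains a member of F of colour c.  For a given c not all
    j occur, because these members would be r disjoint ones of the same colour;
    hence #|L(X)| <= t (r - 1).  Define the height of X as the alternation
    number of X if L(X) is empty, and as alt + #|L(X)| otherwise.  Then the
    height is monotone in X and lies between 1 and alt + t (r - 1).  One can
    also attach to X a sign, equivariantly, that does not change between
    X <= Y of equal height: the first sign of X if L(X) is empty, and otherwise
    the mean, in the field Z/r, of the signs that occur in L(X) with a
    selected colour.

    It remains to know that every equivariant map from nonzero sign vectors of
    length n to Z/r has n comparable vectors X_1 <= .. <= X_n whose consecutive
    images differ (vec_alternating_chain): along this chain the height
    increases strictly, so n <= alt + t (r - 1).  This is the topological core,
    a form of the Borsuk-Ulam theorem for Z/r, and it is proved by a degree
    computation.  The sign vectors supported on the first k + 1 places form a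
    sphere-like poset which carries a k-chain h_k, built recursively by coning
    either the difference of h_(k-1) and its translate, or the sum of all the
    translates of h_(k-1) (sphere_chain).  On tuples of residues there is an
    explicit cochain c, with values in Z/r, whose coboundary follows the
    same two-step pattern (cyclic_cochain_even, cyclic_cochain_odd) and which
    vanishes on tuples with two equal consecutive entries
    (cyclic_cochain_neq0).  Pairing the pull-back of c with all translates of
    h_k gives a sum that does not depend on k modulo r (degreeS) and is 1 for
    k = 0; hence it is not zero for k = n - 1.

    Composite numbers of signs are handled by refinement (kneser_bound_prod).
    For r = r1 r2, consider the sets that contain r1 disjoint members of F of
    one colour, and give such a set this colour.  The bound for r2 yields an
    alternating vector X that avoids these sets, and the bound for r1, applied
    inside each letter set of X, refines it to a vector with r1 r2 signs.
    This works because the statement produces a vector that is already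
    alternating along the enumeration: neighbours of the refined
    vector differ either in the coarse sign, or as neighbours inside one letter
    set. *)

Set Implicit Arguments.
Unset Strict Implicit.
Unset Printing Implicit Defensive.

(** * Ordered tuples: coboundary, prism and cone *)

Section Coboundary.
Variables (R : comNzRingType) (T : Type).
Implicit Types (F G : seq T -> R) (t u : seq T).
Local Open Scope ring_scope.

(** The alternating sum of F over the tuples obtained by deleting one entry of
    t, unfolded at the first entry.  Deleting the entry of a 1-tuple leaves the
    empty tuple, so the complex is augmented. *)
Fixpoint coboundary F t : R :=
  if t is x :: u then F u - coboundary (fun v => F (x :: v)) u else 0.

Lemma eq_coboundary F G : F =1 G -> coboundary F =1 coboundary G.
Proof.
move=> eqFG t; elim: t F G eqFG => //= x u IH F G eqFG.
by rewrite eqFG (IH _ (fun v => G (x :: v))).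
Qed.

Lemma coboundaryB F G t :
  coboundary (fun v => F v - G v) t = coboundary F t - coboundary G t.
Proof. by elim: t F G => [|x u IH] F G /=; rewrite ?IH; ring. Qed.

Lemma coboundaryZ a F t :
  coboundary (fun v => a * F v) t = a * coboundary F t.
Proof. by elim: t F => [|x u IH] F /=; rewrite ?IH; ring. Qed.

Lemma coboundary_map (g : T -> T) F t :
  coboundary (fun v => F (map g v)) t = coboundary F (map g t).
Proof. by elim: t F => //= x u IH F; rewrite (IH (fun v => F (g x :: v))). Qed.

Section Cone.
Variables (up : T -> T) (apex : T).

(** Chains are handled through the cochains that they are paired with: prism F
    and cone F are the transposes of the chain operators.  For t = (x0 .. xj)
    the prism chain is the alternating sum of (x0 .. xi, up xi .. up xj), a
    homotopy from t to its image under up; the cone adds the simplex joining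
    the apex to that image, so that it fills any cycle. *)
Fixpoint prism F t : R :=
  if t is x :: u then
    F (x :: up x :: map up u) - prism (fun v => F (x :: v)) u
  else 0.

Definition cone F t : R := F (apex :: map up t) - prism F t.

Lemma eq_prism F G : F =1 G -> prism F =1 prism G.
Proof.
move=> eqFG t; elim: t F G eqFG => //= x u IH F G eqFG.
by rewrite eqFG (IH _ (fun v => G (x :: v))).
Qed.

Lemma prismB F G t :
  prism (fun v => F v - G v) t = prism F t - prism G t.
Proof. by elim: t F G => [|x u IH] F G /=; rewrite ?IH; ring. Qed.

(** The usual homotopy formula: the boundary of a prism consists of its top, its
    bottom, and the prism over the boundary. *)
Lemma prism_coboundary F t :
  prism (coboundary F) t + coboundary (prism F) t = F (map up t) - F t.
Proof.
elim: t F => [|x u IH] F /=; first by ring.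
rewrite !prismB !coboundaryB -(coboundary_map up (fun v => F (x :: up x :: v))).
have := IH (fun v => F (x :: v)); set P := prism _ _; set Q := coboundary _ _.
move=> e; have -> : P = F (x :: map up u) - F (x :: u) - Q by rewrite -e; ring.
by ring.
Qed.

(** The cone is a contraction of the augmented complex: this is what makes a
    cycle the boundary of its cone. *)
Lemma cone_coboundary F t :
  cone (coboundary F) t + coboundary (cone F) t = F t.
Proof.
rewrite /cone /= coboundaryB (coboundary_map up (fun v => F (apex :: v))).
have := prism_coboundary F t; set P := prism _ _; set Q := coboundary _ _ => e.
have -> : P = F (map up t) - F t - Q by rewrite -e; ring.
by ring.
Qed.

End Cone.
End Coboundary.

(** * A periodic cochain on tuples of residues *)

Section CyclicCochain.
Variables (R : comNzRingType) (p : nat).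
Local Notation r := p.+2.
Local Notation Z := 'I_p.+2.
Local Open Scope ring_scope.

Definition descent (x y : Z) : R := (y < x)%N%:R.

(** The coboundary of descent.  It only depends on the cyclic order of the three
    residues, hence it is a translation invariant 2-cocycle. *)
Definition cyclic_turn (x y z : Z) : R :=
  descent y z - descent x z + descent x y.

(** The cup product of as many copies of cyclic_turn as fit on t with a factor
    on the last one or two entries.  It is the coefficient at the identity of an
    equivariant chain map from the homogeneous bar resolution of the cyclic
    group to its periodic resolution. *)
Fixpoint cyclic_cochain (t : seq Z) : R :=
  match t with
  | [::] => 1
  | [:: x] => (x == ord_max)%:R
  | x :: (y :: t') as t1 =>
      if t' is z :: _ then cyclic_turn x y z * cyclic_cochain t' 
      else descent x y
  end.

(** Translation by 1 preserves the order of two residues except that the largest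
    one wraps around to 0. *)
Lemma descent_shift x y :
  descent (x + 1) (y + 1) =
    descent x y + (y == ord_max)%:R - (x == ord_max)%:R.
Proof.
have neq_max (z : Z) : z != ord_max -> (z < p.+1)%N.
  by rewrite -val_eqE /= => nz; rewrite ltn_neqAle nz -ltnS ltn_ord.
have val1 (z : Z) : val (z + 1) = (if z == ord_max then 0 else z.+1)%N.
  case: eqVneq => [->|/neq_max z_lt] /=; first by rewrite addn1 modnn.
  by rewrite modn_small ?addn1.
rewrite /descent !val1.
case: eqVneq => [->|/neq_max nx]; case: eqVneq => [->|/neq_max ny] /=.
- by rewrite !ltnn /=; ring.
- by rewrite (ltnNge p.+1) (ltnW ny) /=; ring.
- by rewrite nx /=; ring.
- by rewrite ltnS; ring.
Qed.

Lemma cyclic_turn_shift1 x y z :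
  cyclic_turn (x + 1) (y + 1) (z + 1) = cyclic_turn x y z.
Proof. by rewrite /cyclic_turn !descent_shift; ring. Qed.

Lemma shift1_invariant (T : Type) (d : Z -> T) :
  (forall a, d (a + 1) = d a) -> forall a, d a = d 0.
Proof.
move=> dS a; rewrite -(natr_Zp a).
by elim: (nat_of_ord a) => // m IH; rewrite -addn1 natrD dS.
Qed.

Lemma cyclic_turn_shift x y z a :
  cyclic_turn (x + a) (y + a) (z + a) = cyclic_turn x y z.
Proof.
pose d a := cyclic_turn (x + a) (y + a) (z + a).
rewrite -/(d a) (@shift1_invariant _ d) /d ?addr0 // => b.
by rewrite !addrA cyclic_turn_shift1.
Qed.

Lemma cyclic_cochain_consE x y z u :
  cyclic_cochain [:: x, y, z & u] =
  cyclic_turn x y z * cyclic_cochain (z :: u).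
Proof. by []. Qed.

(** The Leibniz rule for the cup product, cyclic_turn being a cocycle; it reduces
    both relations below to tuples with at most two entries. *)
Lemma coboundary_cyclic_cochain x y z u :
  coboundary cyclic_cochain [:: x, y, z & u] =
  cyclic_turn x y z * coboundary cyclic_cochain (z :: u).
Proof.
rewrite [LHS]/= [in RHS]/=.
under eq_coboundary => v do rewrite -/(cyclic_cochain (z :: v)).
rewrite coboundaryZ.
case: u => [|w u] /=; first by rewrite /cyclic_turn; ring.
by rewrite /cyclic_turn; ring.
Qed.

Lemma cyclic_cochain_even t : ~~ odd (size t) ->
  cyclic_cochain [seq x + 1 | x <- t] - cyclic_cochain t =
  coboundary cyclic_cochain t.
Proof.
have [m] := ubnP (size t); elim: m t => // m IH [|x [|y [|z u]]] // ht od.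
- by rewrite /= subrr.
- by rewrite /= descent_shift; ring.
rewrite coboundary_cyclic_cochain -IH; last 2 first.
- by move: ht => /=; lia.
- by move: od => /=; rewrite !negbK.
by rewrite !map_cons !cyclic_cochain_consE cyclic_turn_shift1; ring.
Qed.

Lemma cyclic_cochain_odd t : odd (size t) ->
  \sum_(a : Z) cyclic_cochain [seq x + a | x <- t] =
  coboundary cyclic_cochain t.
Proof.
have [m] := ubnP (size t); elim: m t => // m IH [|x [|y [|z u]]] // ht od.
  rewrite /= subr0 (bigD1 (ord_max - x)) //= [x + _]addrC subrK eqxx.
  rewrite big1 ?addr0 // => a; case: (x + a =P ord_max) => [<-|//].
  by rewrite addrC addKr eqxx.
rewrite coboundary_cyclic_cochain -IH; last 2 first.
- by move: ht => /=; lia.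
- by move: od => /=; rewrite !negbK.
rewrite mulr_sumr; apply: eq_bigr => a _.
by rewrite !map_cons cyclic_cochain_consE cyclic_turn_shift.
Qed.

Lemma descentxx x : descent x x = 0.
Proof. by rewrite /descent ltnn. Qed.

Lemma cyclic_turn_neq0 x y z : cyclic_turn x y z != 0 -> (x != y) && (y != z).
Proof.
apply: contraNT; rewrite negb_and !negbK => /orP[] /eqP ->;
  by rewrite /cyclic_turn descentxx; apply/eqP; ring.
Qed.

(** Normalization: degenerate tuples do not count.  Thus a nonzero value detects
    a tuple in which consecutive signs differ. *)
Lemma cyclic_cochain_neq0 t :
  cyclic_cochain t != 0 -> sorted (fun x y => x != y) t.
Proof.
have [m] := ubnP (size t); elim: m t => // m IH [|x [|y [|z u]]] // ht.
  by rewrite /=; case: (eqVneq x y) => // ->; rewrite descentxx eqxx.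
rewrite cyclic_cochain_consE => nz.
have /cyclic_turn_neq0/andP[xy yz] : cyclic_turn x y z != 0.
  by apply: contraNneq nz => ->; rewrite mul0r.
rewrite /= xy yz; apply: (IH (z :: u)); first by move: ht => /=; lia.
by apply: contraNneq nz => ->; rewrite mulr0.
Qed.

End CyclicCochain.

Arguments cyclic_cochain R {p} t.

(** * Chains of sign vectors *)

Section SignVectors.
Variables (I : finType) (S : eqType).
Implicit Types X Y : {ffun I -> option S}.

Definition vec0 : {ffun I -> option S} := [ffun=> None].

Definition vec_le X Y := [forall i, X i ==> (X i == Y i)].

Lemma vec_leP X Y : reflect (forall i, X i -> X i = Y i) (vec_le X Y).
Proof.
apply: (iffP forallP) => XY i.
  by move=> Xi; apply/eqP; move: (XY i); rewrite Xi.
by apply/implyP => /XY/eqP.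
Qed.

Lemma vec_lexx X : vec_le X X.
Proof. exact/vec_leP. Qed.

Lemma vec0_le X : vec_le vec0 X.
Proof. by apply/vec_leP => i; rewrite ffunE. Qed.

Lemma vec_neq0P X : reflect (exists i, X i) (X != vec0).
Proof.
apply: (iffP idP) => [nz|[i Xi]]; last by apply: contraTneq Xi => ->; rewrite ffunE.
apply/existsP; apply: contraNT nz => /existsPn X0; apply/eqP/ffunP => i.
by rewrite ffunE; case: (X i) (X0 i).
Qed.

End SignVectors.

Section Chains.
Variables (p : nat) (I : finType) (e : seq I).
Hypothesis e_uniq : uniq e.
Local Notation r := p.+2.
Local Notation Z := 'I_p.+2.
Local Notation V := {ffun I -> option Z}.
Local Open Scope ring_scope.
Implicit Types (X Y : V) (t u : seq V).

Definition rotate (a : Z) X : V := [ffun i => omap (fun z => z + a) (X i)].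

Lemma rotateE a X i : rotate a X i = omap (fun z => z + a) (X i).
Proof. exact: ffunE. Qed.

Lemma isSome_rotate a X i : isSome (rotate a X i) = isSome (X i).
Proof. by rewrite rotateE; case: (X i). Qed.

Lemma rotateD a b X : rotate a (rotate b X) = rotate (b + a) X.
Proof. by apply/ffunP => i; rewrite !rotateE; case: (X i) => //= z; rewrite addrA. Qed.

Lemma rotate0 X : rotate 0 X = X.
Proof. by apply/ffunP => i; rewrite !rotateE; case: (X i) => //= z; rewrite addr0. Qed.

Lemma rotate_le a X Y : vec_le X Y -> vec_le (rotate a X) (rotate a Y).
Proof.
move=> /vec_leP XY; apply/vec_leP => i; rewrite isSome_rotate !rotateE => Xi.
by rewrite XY.
Qed.

Lemma rotate_neq0 a X : (rotate a X != vec0 I Z) = (X != vec0 I Z).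
Proof.
by apply/vec_neq0P/vec_neq0P => -[i Xi]; exists i; move: Xi; rewrite isSome_rotate.
Qed.

(** The place numbered k is recognized by its index in e, so that no default
    vertex is needed. *)
Definition set_coord (k : nat) X : V :=
  [ffun i => if index i e == k then Some 0 else X i].

(** The nonzero vectors supported on the first k places of e. *)
Definition initial (k : nat) X :=
  (X != vec0 I Z) && [forall i, X i ==> (index i e < k)%N].

Lemma initialP k X :
  reflect (X != vec0 I Z /\ forall i, X i -> (index i e < k)%N) (initial k X).
Proof.
apply: (iffP andP) => -[nz supp]; split=> //.
  by move=> i; apply/implyP; apply: (forallP supp).
by apply/forallP => i; apply/implyP/supp.
Qed.

Lemma set_coord_ge k X : initial k X -> vec_le X (set_coord k X).
Proof.
case/initialP=> _ supp; apply/vec_leP => i /supp lt_i.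
by rewrite ffunE ltn_eqF.
Qed.

Lemma set_coord_le k X Y : vec_le X Y -> vec_le (set_coord k X) (set_coord k Y).
Proof.
move=> /vec_leP XY; apply/vec_leP => i; rewrite !ffunE.
by case: eqP => // _ /XY.
Qed.

Lemma initial_set_coord k X : (k < size e)%N ->
  initial k X || (X == vec0 I Z) -> initial k.+1 (set_coord k X).
Proof.
move=> lt_k Xk; apply/initialP; split.
  have i0 : I by case: (e) lt_k.
  by apply/vec_neq0P; exists (nth i0 e k); rewrite ffunE index_uniq ?eqxx.
move=> i; rewrite ffunE; case: eqP => [->//|_ Xi].
case/orP: Xk => [/initialP[_ /(_ i Xi)]|/eqP X0]; first exact: ltnW.
by move: Xi; rewrite X0 ffunE.
Qed.

Lemma initialW k X : initial k X -> initial k.+1 X.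
Proof.
by case/initialP=> nz supp; apply/initialP; split=> // i /supp/ltnW.
Qed.

Lemma initial_has k X : (k <= size e)%N -> initial k X -> has (isSome \o X) e.
Proof.
move=> le_k /initialP[/vec_neq0P[i Xi] supp]; apply/hasP; exists i => //.
by rewrite -index_mem (leq_trans (supp i Xi)).
Qed.

Lemma initial_rotate a k X : initial k (rotate a X) = initial k X.
Proof.
rewrite /initial rotate_neq0; congr (_ && _); apply: eq_forallb => i.
by rewrite isSome_rotate.
Qed.

Variable R : comNzRingType.
Hypothesis charR : r%:R = 0 :> R.
Implicit Types F G : seq V -> R.

Definition act (a : Z) F t : R := F (map (rotate a) t).

Lemma actD a b F t : act a (act b F) t = act (a + b) F t.
Proof.
by rewrite /act -map_comp; congr F; apply: eq_map => X /=; rewrite rotateD.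
Qed.

(** For X supported on the first k places, X <= set_coord k X >= set_coord k 0;
    these two comparisons contract the vectors supported there inside those
    supported on the first k + 1 places. *)
Definition cocone k F t := cone (set_coord k) (set_coord k (vec0 I Z)) F t.

(** The value of the cochain F on a k-chain h_k of vectors supported on the first
    k + 1 places.  With g the translation of the signs by 1, h_k is the cone over
    g h_(k-1) - h_(k-1) if k is odd, and over the sum of all g^a h_(k-1)
    if k > 0 is even. *)
Fixpoint sphere_chain (k : nat) F : R :=
  if k is k'.+1 then
    let G := cocone k'.+1 F in
    if odd k then sphere_chain k' (act 1 G) - sphere_chain k' G
    else \sum_(a : Z) sphere_chain k' (act a G)
  else cocone 0 F [::].

(** The tuples on which h_k is supported.  Starting the path at the zero vector,
    which is below everything, makes sortedness pass to tails and prefixes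
    alike. *)
Definition on_chain k t :=
  [&& size t == k.+1, path (@vec_le I Z) (vec0 I Z) t & all (initial k.+1) t].

Lemma on_chain_rotate a k t : on_chain k t -> on_chain k (map (rotate a) t).
Proof.
case/and3P=> /eqP sz lt_t init_t; apply/and3P; split; first by rewrite size_map sz.
  have -> : vec0 I Z = rotate a (vec0 I Z) by apply/ffunP => i; rewrite !ffunE.
  by apply: homo_path lt_t => X Y; apply: rotate_le.
by rewrite all_map; apply: sub_all init_t => X /=; rewrite initial_rotate.
Qed.

Lemma eq_prism_chain k X0 t F G : path (@vec_le I Z) X0 t ->
  all (initial k) t -> (k < size e)%N ->
  (forall u, size u = (size t).+1 -> path (@vec_le I Z) X0 u ->
    all (initial k.+1) u -> F u = G u) ->
  prism (set_coord k) F t = prism (set_coord k) G t.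
Proof.
move=> + + lt_k; elim: t X0 F G => //= X t IH X0 F G /andP[X0X Xt] /andP[Xk tk] FG.
have lift_le : {homo set_coord k : X Y / vec_le X Y} by apply: set_coord_le.
rewrite FG; last 3 first.
- by rewrite /= size_map.
- by rewrite /= X0X (set_coord_ge Xk) (homo_path lift_le Xt).
- rewrite /= (initialW Xk) initial_set_coord ?Xk // all_map.
  by apply: sub_all tk => Y Yk /=; rewrite initial_set_coord ?Yk.
congr (_ - _); apply: IH Xt tk _ => u szu Xu uk.
by apply: FG; rewrite /= ?szu ?X0X ?(initialW Xk).
Qed.

Lemma eq_cocone k t F G : (k < size e)%N ->
  size t = k -> path (@vec_le I Z) (vec0 I Z) t -> all (initial k) t ->
  (forall u, on_chain k u -> F u = G u) -> cocone k F t = cocone k G t.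
Proof.
move=> lt_k szt t_le tk FG; rewrite /cocone /cone FG; last first.
  apply/and3P; split; rewrite /= ?size_map ?szt //.
    rewrite vec0_le; apply: (homo_path _ t_le); exact: set_coord_le.
  rewrite initial_set_coord ?eqxx ?orbT // all_map.
  by apply: sub_all tk => Y Yk /=; rewrite initial_set_coord ?Yk.
congr (_ - _); apply: eq_prism_chain t_le tk lt_k _ => u szu u_le uk.
by apply: FG; apply/and3P; rewrite szu szt.
Qed.

(** Locality: only tuples on the chain matter.  It allows the use of
    relations that fail for the zero vector or for vectors with large support,
    and in the end turns a nonzero pairing into the existence of a tuple. *)
Lemma eq_sphere_chain k F G : (k < size e)%N ->
  (forall t, on_chain k t -> F t = G t) -> sphere_chain k F = sphere_chain k G.
Proof.
elim: k F G => [|k IH] F G lt_k FG; first exact: eq_cocone.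
have FG' a t : on_chain k t -> act a (cocone k.+1 F) t = act a (cocone k.+1 G) t.
  by move=> /(on_chain_rotate a)/and3P[/eqP szt t_le tk]; apply: eq_cocone FG.
rewrite /=; case: ifP => _.
  congr (_ - _); apply: (IH _ _ (ltnW lt_k)) => t tk; first exact: FG'.
  have rot0 : map (rotate 0) t = t by rewrite (eq_map rotate0) map_id.
  by have := FG' 0 t tk; rewrite /act rot0.
by apply: eq_bigr => a _; apply: (IH _ _ (ltnW lt_k)) => t /FG'.
Qed.

Lemma eq_sphere_chain_fun k F G : F =1 G -> sphere_chain k F = sphere_chain k G.
Proof.
elim: k F G => [|k IH] F G FG.
  by rewrite /= /cocone /cone FG (eq_prism _ FG).
have eqG : cocone k.+1 F =1 cocone k.+1 G.
  by move=> t; rewrite /cocone /cone FG (eq_prism _ FG).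
rewrite /=; case: ifP => _; first by congr (_ - _); apply: IH => // t; apply: eqG.
by apply: eq_bigr => a _; apply: IH => t; apply: eqG.
Qed.

Lemma coconeB k F G t :
  cocone k (fun u => F u - G u) t = cocone k F t - cocone k G t.
Proof. by rewrite /cocone /cone prismB; ring. Qed.

Lemma sphere_chainB k F G :
  sphere_chain k (fun t => F t - G t) = sphere_chain k F - sphere_chain k G.
Proof.
elim: k F G => [|k IH] F G; first exact: coconeB.
have IHc a : sphere_chain k (act a (cocone k.+1 (fun t => F t - G t))) =
    sphere_chain k (act a (cocone k.+1 F)) - sphere_chain k (act a (cocone k.+1 G)).
  by rewrite -IH; apply: eq_sphere_chain_fun => t; rewrite /act coconeB.
rewrite /=; case: ifP => _; last by under eq_bigr do rewrite IHc; rewrite sumrB.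
rewrite IHc (eq_sphere_chain_fun k (coconeB k.+1 F G)) IH; ring.
Qed.

Lemma sphere_chain0 k : sphere_chain k (fun=> 0) = 0.
Proof.
rewrite (@eq_sphere_chain_fun k _ (fun=> 0 - 0)) => [|t]; last by rewrite subr0.
by rewrite sphere_chainB subrr.
Qed.

Lemma sphere_chainD k F G :
  sphere_chain k (fun t => F t + G t) = sphere_chain k F + sphere_chain k G.
Proof.
rewrite -[in RHS](opprK (sphere_chain k G)) -[- sphere_chain k G]add0r.
rewrite -[in RHS](sphere_chain0 k) -!sphere_chainB.
by apply: eq_sphere_chain_fun => t; ring.
Qed.

Lemma sphere_chain_sum k (J : Type) (js : seq J) (Fs : J -> seq V -> R) :
  sphere_chain k (fun t => \sum_(j <- js) Fs j t) =
  \sum_(j <- js) sphere_chain k (Fs j).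
Proof.
elim: js => [|j js IH].
  rewrite [RHS]big_nil -[RHS](sphere_chain0 k).
  by apply: eq_sphere_chain_fun => t; rewrite big_nil.
rewrite big_cons -IH -sphere_chainD.
by apply: eq_sphere_chain_fun => t; rewrite big_cons.
Qed.

Lemma coboundary_act a F t : coboundary (act a F) t = act a (coboundary F) t.
Proof. exact: coboundary_map. Qed.

(** Pairing with the cycle whose cone is the next chain. *)
Definition orbit_step (odd_k : bool) k F : R :=
  if odd_k then sphere_chain k (act 1 F) - sphere_chain k F
  else \sum_(a : Z) sphere_chain k (act a F).

Lemma sphere_chainS k F :
  sphere_chain k.+1 F = orbit_step (odd k.+1) k (cocone k.+1 F).
Proof. by []. Qed.

Lemma eq_orbit_step b k F G : F =1 G -> orbit_step b k F = orbit_step b k G.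
Proof.
move=> FG; rewrite /orbit_step; case: b.
  by congr (_ - _); apply: eq_sphere_chain_fun => // t; apply: FG.
by apply: eq_bigr => a _; apply: eq_sphere_chain_fun => t; apply: FG.
Qed.

Lemma orbit_stepB b k F G :
  orbit_step b k (fun t => F t - G t) = orbit_step b k F - orbit_step b k G.
Proof.
rewrite /orbit_step; case: b.
  by rewrite sphere_chainB (sphere_chainB k (act 1 F) (act 1 G)); ring.
rewrite -sumrB; apply: eq_bigr => a _.
exact: (sphere_chainB k (act a F) (act a G)).
Qed.

Lemma sum_act k b F :
  \sum_(a : Z) sphere_chain k (act a (act b F)) = \sum_(a : Z) sphere_chain k (act a F).
Proof.
rewrite [RHS](reindex_inj (addIr b)) /=.
by apply: eq_bigr => a _; apply: eq_sphere_chain_fun => t; rewrite actD.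
Qed.

(** The boundary of a cone over a cycle is that cycle.  It is a cycle since the
    two orbit steps compose to zero: translating a sum over all
    translates does not change it. *)
Lemma sphere_chain_coboundary k F :
  sphere_chain k.+1 (coboundary F) = orbit_step (odd k.+1) k F.
Proof.
have coconeE j G t :
    cocone j (coboundary G) t = G t - coboundary (cocone j G) t.
  by rewrite -[X in X - _](cone_coboundary (set_coord j) (set_coord j (vec0 I Z))) addrK.
elim: k F => [|k IH] F; rewrite sphere_chainS (eq_orbit_step _ _ (coconeE _ F));
  rewrite orbit_stepB -[RHS]subr0; congr (_ - _).
  by rewrite /orbit_step /= /cocone /cone /act /=; ring.
set G := cocone _ _; rewrite {1}/orbit_step.
have bnd a : sphere_chain k.+1 (act a (coboundary G)) = orbit_step (odd k.+1) k (act a G).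
  by rewrite -IH; apply: eq_sphere_chain_fun => t; rewrite coboundary_act.
rewrite bnd IH oddS; case: (odd k.+1) bnd => /= bnd; last first.
  by rewrite /orbit_step sum_act subrr.
under eq_bigr do rewrite bnd.
rewrite /orbit_step sumrB -[X in _ - X](sum_act k 1) /=.
apply/eqP; rewrite subr_eq0; apply/eqP/eq_bigr => a _.
by apply: eq_sphere_chain_fun => t; rewrite !actD addrC.
Qed.

Section Labelling.
Variable s : V -> Z.
Hypothesis s_rotate :
  forall a X, has (isSome \o X) e -> s (rotate a X) = s X + a.

Definition label_cochain t : R := cyclic_cochain R (map s t).

Lemma act_label k a t : (k < size e)%N -> on_chain k t ->
  act a label_cochain t = cyclic_cochain R [seq x + a | x <- map s t].
Proof.
move=> lt_k /and3P[_ _ /allP t_init]; rewrite /act /label_cochain.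
rewrite -!map_comp; congr cyclic_cochain.
by apply/eq_in_map => X /t_init/(initial_has lt_k) nz /=; rewrite s_rotate.
Qed.

Lemma coboundary_label t :
  coboundary label_cochain t = coboundary (cyclic_cochain R) (map s t).
Proof.
rewrite /label_cochain; elim: t (cyclic_cochain R) => //= X t IH c.
by rewrite (IH (fun v => c (s X :: v))).
Qed.

(** The augmentation of the image of h_k in the periodic resolution, that is the
    pairing summed over all translates. *)
Definition degree k := \sum_(a : Z) sphere_chain k (act a label_cochain).

Lemma degree0 : (0 < size e)%N -> degree 0 = 1.
Proof.
move=> e_gt0.
rewrite /degree -sphere_chain_sum -[RHS](_ : sphere_chain 0 (fun=> 1) = 1); last first.
  by rewrite /= /cocone /cone /= subr0.
apply: eq_sphere_chain => // t t0.
under eq_bigr do rewrite (act_label _ e_gt0 t0).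
have /and3P[/eqP szt _ _] := t0.
rewrite cyclic_cochain_odd ?size_map ?szt //.
by case: t szt {t0} => [|X []] //= _; rewrite subr0.
Qed.

(** Stokes' formula, in two cases.  For even k + 1 the summed cochain is a
    coboundary, and the boundary of the chain is the sum of all translates of
    the previous one.  For odd k + 1 the pairings of h_(k+1) and
    h_k with the translate by a differ by d a, which does not depend on a; so
    the degrees differ by r times a constant, which is zero in R. *)
Lemma degreeS k : (k.+1 < size e)%N -> degree k.+1 = degree k.
Proof.
move=> lt_k; case odd_k: (odd k.+1); last first.
  rewrite /degree -sphere_chain_sum.
  have -> : sphere_chain k.+1 (fun t => \sum_(a : Z) act a label_cochain t) =
      sphere_chain k.+1 (coboundary label_cochain).
    apply: eq_sphere_chain => // t tk; rewrite coboundary_label -cyclic_cochain_odd.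
      by apply: eq_bigr => a _; rewrite (act_label _ lt_k tk).
    by have /and3P[/eqP szt _ _] := tk; rewrite size_map szt oddS odd_k.
  by rewrite sphere_chain_coboundary odd_k.
pose d a :=
  sphere_chain k.+1 (act a label_cochain) - sphere_chain k (act a label_cochain).
have d1 a : d (a + 1) = d a.
  have : sphere_chain k.+1 (act (a + 1) label_cochain) -
      sphere_chain k.+1 (act a label_cochain) =
      sphere_chain k.+1 (coboundary (act a label_cochain)).
    rewrite -sphere_chainB; apply: eq_sphere_chain => // t tk.
    rewrite coboundary_act -actD; have tak := on_chain_rotate a tk.
    rewrite -[act a _ t]/(act 1 label_cochain (map (rotate a) t)) (act_label _ lt_k tak).
    rewrite -[act a (coboundary _) t]/(coboundary label_cochain (map (rotate a) t)).
    rewrite coboundary_label.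
    have /and3P[/eqP szt _ _] := tk.
    by rewrite -cyclic_cochain_even ?size_map ?szt // oddS odd_k.
  rewrite sphere_chain_coboundary odd_k /orbit_step.
  rewrite (@eq_sphere_chain_fun k _ (act (a + 1) label_cochain)) => [eq_d|t].
    move: eq_d; rewrite /d; set A1 := sphere_chain _ _; set A0 := sphere_chain _ _.
    set B1 := sphere_chain _ _; set B0 := sphere_chain _ _ => eq_d.
    by rewrite -[A1](subrK A0) eq_d; ring.
  by rewrite actD addrC.
apply/eqP; rewrite -subr_eq0 /degree -sumrB (eq_bigr (fun=> d 0)) => [|a _].
  by rewrite sumr_const card_ord -mulr_natr charR mulr0.
exact: shift1_invariant.
Qed.

Lemma degree_eq1 k : (k < size e)%N -> degree k = 1.
Proof. by elim: k => [|k IH] lt_k; [apply: degree0 | rewrite degreeS // IH // ltnW]. Qed.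

End Labelling.
End Chains.

(** A Borsuk-Ulam theorem for the cyclic group: an equivariant labelling of the
    sign vectors changes at every step of some chain with as many vectors as there are
    places.  A chain without repetitions has no room for more. *)
Lemma vec_alternating_chain (p : nat) (I : finType) (e : seq I)
    (s : {ffun I -> option 'I_p.+2} -> 'I_p.+2) :
  uniq e ->
  (forall a (X : {ffun I -> option _}), has (isSome \o X) e ->
     s (rotate a X) = (s X + a)%R) ->
  exists t : (size e).-tuple {ffun I -> option 'I_p.+2},
    [/\ sorted (@vec_le I _) t,
        all (fun X : {ffun I -> option _} => has (isSome \o X) e) t
      & sorted (fun x y => x != y) (map s t)].
Proof.
move=> e_uniq s_rot; case sz_e: (size e) => [|n]; first by exists [tuple].
have lt_n : n < size e by rewrite sz_e.
have char0 : (p.+2%:R = 0 :> 'I_p.+2)%R by exact: (@pchar_Zp p.+2).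
have deg := degree_eq1 e_uniq char0 s_rot lt_n.
pose good (t : n.+1.-tuple {ffun I -> option 'I_p.+2}) :=
  on_chain e n t && (label_cochain 'I_p.+2 s t != 0)%R.
have [t /andP[/and3P[_ t_le t_init] t_nz]|none] := pickP good.
  exists t; split; last exact: cyclic_cochain_neq0 t_nz.
    exact: path_sorted t_le.
  by apply: sub_all t_init => X; apply: initial_has.
have /eqP := deg; rewrite /degree big1 1?eq_sym ?oner_eq0 // => a _.
rewrite -[RHS](@sphere_chain0 p I e _ n); apply: eq_sphere_chain => // t tn.
have t'n := on_chain_rotate a tn; have /and3P[sz _ _] := t'n.
by have := none (Tuple sz); rewrite /good /= t'n /= => /negbFE/eqP.
Qed.

(** * Alternating subsequences of sign vectors *)

Section AltSeq.
Variable T : eqType.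
Implicit Types u s : seq (option T).

Lemma leq_alt_seq u s : alternating u -> subseq u s -> size u <= alt_seq s.
Proof.
move=> alt_u /subseqP[m /eqP sz_m u_m]; rewrite u_m in alt_u *.
pose masked (m : (size s).-tuple bool) := size (mask m s).
exact: (@leq_bigmax_cond _ _ masked (Tuple sz_m)).
Qed.

Lemma alt_seq_attained s :
  exists u, [/\ alternating u, subseq u s & size u = alt_seq s].
Proof.
have [|m alt_m max_m] := @eq_bigmax_cond _
    [pred m : (size s).-tuple bool | alternating (mask m s)] (fun m => size (mask m s)).
  apply/card_gt0P; exists [tuple of nseq (size s) false].
  by rewrite inE /= mask_false.
by exists (mask m s); rewrite mask_subseq -max_m.
Qed.

End AltSeq.

Section AltVec.
Variables (I : finType) (S : eqType).
Implicit Types (X Y : {ffun I -> option S}) (e : seq I) (u : seq (option S)).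

Lemma subseq_vec_le e u X Y : vec_le X Y -> all isSome u ->
  subseq u (map X e) -> subseq u (map Y e).
Proof.
move=> /vec_leP XY; elim: e u => [|i e IH] [|x u] //= /andP[x_some u_some].
case: eqP => [x_Xi|_] u_sub.
  by rewrite -XY -?x_Xi ?eqxx //; apply: IH.
case: ifP => _; last by apply: IH; rewrite //= x_some.
by apply: (IH u u_some); apply: subseq_trans u_sub; apply: subseq_cons.
Qed.

Lemma leq_alt_seq_vec e X Y : vec_le X Y -> alt_seq (map X e) <= alt_seq (map Y e).
Proof.
move=> XY; have [u [alt_u u_sub <-]] := alt_seq_attained (map X e).
apply: leq_alt_seq => //; case/andP: alt_u => u_some _.
exact: subseq_vec_le XY u_some u_sub.
Qed.

(** As Y extends X, it has the letter a where the subsequence of X starts, so its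
    first letter y occurs there or earlier; there only if y = a.  So for a != y
    it can be put in front. *)
Lemma subseq_prepend_first e y a u X Y : vec_le X Y -> all isSome u ->
    ohead (pmap Y e) = Some y -> a != y -> subseq (Some a :: u) (map X e) ->
  subseq [:: Some y, Some a & u] (map Y e).
Proof.
move=> XY u_some; elim: e => //= i e IH; have := vec_leP _ _ XY i.
case: (Y i) => [z|] /=.
  case: (X i) => [x|] /=; last first.
    move=> _ [->] _ u_sub; rewrite eqxx.
    exact: (subseq_vec_le XY _ u_sub).
  move=> /(_ isT)[->] [->] /negPf a_ne; rewrite eqxx -[Some a == Some y]/(a == y) a_ne.
  by apply: (subseq_vec_le XY).
case: (X i) => [x /(_ isT)//|] _; exact: IH.
Qed.

(** Otherwise prepending the first letter of Y would give a longer alternating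
    subsequence of Y. *)
Lemma alternating_first e X Y x a u : vec_le X Y ->
    alt_seq (map X e) = alt_seq (map Y e) -> ohead (pmap Y e) = Some x ->
    alternating (Some a :: u) -> subseq (Some a :: u) (map X e) ->
    size (Some a :: u) = alt_seq (map X e) ->
  a = x.
Proof.
move=> XY altXY Yx alt_u u_sub sz_u; apply/eqP; apply: contraT => ax.
have u_some : all isSome u by case/andP: alt_u => /andP[].
suff : (size u).+2 <= alt_seq (map Y e) by rewrite -altXY -sz_u ltnn.
apply: (@leq_alt_seq _ [:: Some x, Some a & u]).
  case/andP: alt_u => _ sorted_u; rewrite /alternating /= u_some.
  by rewrite -[Some x == Some a]/(x == a) eq_sym ax.
exact: subseq_prepend_first XY u_some Yx ax u_sub.
Qed.

Lemma alt_seq_gt0 e X : has (isSome \o X) e -> 0 < alt_seq (map X e).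
Proof.
case/hasP=> i ie /=; case Xi: (X i) => [x|] // _.
apply: (@leq_alt_seq _ [:: Some x]) => //.
by rewrite sub1seq -Xi map_f.
Qed.

(** Both first letters are equal to that of a longest alternating subsequence
    of X, by alternating_first for the pairs X <= Y and X <= X. *)
Lemma first_letter_stable e X Y : vec_le X Y -> has (isSome \o X) e ->
  alt_seq (map X e) = alt_seq (map Y e) ->
  ohead (pmap X e) = ohead (pmap Y e).
Proof.
move=> XY X_nz altXY.
have first (V : {ffun I -> option S}) :
    has (isSome \o V) e -> exists v, ohead (pmap V e) = Some v.
  by elim: (e) => //= i e' IH; case: (V i) => [v|] //= _; exists v.
have Y_nz : has (isSome \o Y) e.
  by apply: sub_has X_nz => i /= Xi; rewrite -(vec_leP _ _ XY).
have [x Xx] := first X X_nz; have [y Yy] := first Y Y_nz.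
have [[|[a|] u] [alt_u u_sub sz_u]] := alt_seq_attained (map X e) => //.
  by have := alt_seq_gt0 X_nz; rewrite -sz_u.
rewrite Xx Yy -(alternating_first XY altXY Yy alt_u u_sub sz_u).
by rewrite -(alternating_first (vec_lexx X) erefl Xx alt_u u_sub sz_u).
Qed.

Lemma exists_alternating_subvec e X : uniq e ->
  exists Y, [/\ vec_le Y X, sorted (fun x y => x != y) (pmap Y e)
              & size (pmap Y e) = alt_seq (map X e)].
Proof.
move=> e_uniq; have [u [/andP[u_some u_alt] u_sub sz_u]] := alt_seq_attained (map X e).
have u_map : u = map Some (pmap id u).
  by elim: u u_some {u_alt u_sub sz_u} => //= -[x|] u IH //= /IH <-.
case/subseqP: u_sub => m sz_m u_m.
pose A := mask m e; pose Y := [ffun i => if i \in A then X i else None].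
have YE : pmap Y e = pmap id u.
  have A_e : A = filter (mem A) e by apply/subseq_uniqP => //; apply: mask_subseq.
  rewrite u_m -map_mask -/A [in RHS]A_e.
  elim: (e) => //= i e' IH; rewrite {1}/Y ffunE; case: ifP => /= _; last exact: IH.
  by case: (X i) => //= x; rewrite IH.
exists Y; split; last by rewrite YE -sz_u [in RHS]u_map size_map.
  by apply/vec_leP => i; rewrite ffunE; case: ifP.
by move: u_alt; rewrite YE {1}u_map sorted_map; apply: sub_sorted => x y.
Qed.

End AltVec.

(** * Sign vectors that avoid a hypergraph *)

Definition letter_set (I : finType) (S : eqType) (X : {ffun I -> option S}) j :
  {set I} := [set i | X i == Some j].

Definition avoids (I S : finType) (F : {set {set I}}) (X : {ffun I -> option S}) :=
  [forall j, forall A in F, ~~ (A \subset letter_set X j)].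

Definition mono_family (I S : finType) (F : {set {set I}}) (f : {set I} -> nat)
    (c : nat) (A : {ffun S -> {set I}}) :=
  [forall j, (A j \in F) && (f (A j) == c)] &&
  [forall j, forall k, (j != k) ==> [disjoint A j & A k]].

(** The statement proved by induction on the number of signs.  Compared with a
    bound on the alternation number it produces an extremal vector that is
    alternating without passing to a subsequence, which is what refinement
    needs.  The enumeration e need not list all vertices, so the
    statement can be used inside a subset of the vertices; and the type S of signs is
    arbitrary, so that pairs of signs are signs. *)
Definition kneser_bound (S : finType) := forall (I : finType) (e : seq I)
    (F : {set {set I}}) (f : {set I} -> nat) (t : nat),
  uniq e -> set0 \notin F -> (forall A, A \in F -> f A < t) ->
  (forall c (A : {ffun S -> {set I}}), ~~ mono_family F f c A) ->
  exists X : {ffun I -> option S},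
    [/\ avoids F X, sorted (fun x y => x != y) (pmap X e)
      & size e <= size (pmap X e) + t * #|S|.-1].

Section FinVec.
Variables I S : finType.
Implicit Types (X Y : {ffun I -> option S}) (F : {set {set I}}).

Lemma letter_set_le X Y j : vec_le X Y -> letter_set X j \subset letter_set Y j.
Proof.
move=> /vec_leP XY; apply/subsetP => i; rewrite !inE => /eqP Xi.
by rewrite -XY Xi.
Qed.

Lemma avoidsP F X :
  reflect (forall j A, A \in F -> ~~ (A \subset letter_set X j)) (avoids F X).
Proof.
apply: (iffP forallP) => H j; first by move=> A AF; apply: (forall_inP (H j)).
by apply/forall_inP => A; apply: H.
Qed.

Lemma avoids_le F X Y : vec_le X Y -> avoids F Y -> avoids F X.
Proof.
move=> XY /avoidsP avY; apply/avoidsP => j A AF.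
apply: contra (avY j A AF) => /subset_trans.
by apply; apply: letter_set_le.
Qed.

Lemma avoids_vec0 F : set0 \notin F -> avoids F (vec0 I S).
Proof.
move=> F0; apply/avoidsP => j A AF; apply: contraNN F0.
rewrite (_ : letter_set _ j = set0) ?subset0 => [/eqP <- //|].
by apply/setP => i; rewrite !inE ffunE.
Qed.

End FinVec.

(** * A prime number of signs *)

Section PrimeSelection.
Variable p : nat.
Local Notation Z := 'I_p.+2.
Hypothesis r_prime : prime p.+2.
Local Open Scope ring_scope.

(** An equivariant choice of a residue attached to a set of residues whose size
    is prime to the modulus.  Primality is needed here: in general a
    nonempty proper subset may be invariant under a nontrivial translation. *)
Definition mean (B : {set Z}) : Z := (\sum_(a in B) a) / #|B|%:R.

Lemma mean_shift (B : {set Z}) b :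
  (0 < #|B| < p.+2)%N -> mean [set a + b | a in B] = mean B + b.
Proof.
case/andP=> B_gt0 B_lt.
have B_unit : (#|B|%:R : 'Z_p.+2) \is a GRing.unit.
  by rewrite unitZpE // prime_coprime // gtnNdvd.
have inj_b : injective (fun a : Z => a + b) by apply: addIr.
rewrite /mean card_imset // big_imset /=; last by move=> x y _ _; apply: inj_b.
by rewrite big_split sumr_const mulrDl -[b *+ _]mulr_natr mulrK.
Qed.

End PrimeSelection.

Section PrimeCase.
Variables (p : nat) (I : finType) (e : seq I) (F : {set {set I}}).
Variables (f : {set I} -> nat) (t : nat).
Local Notation Z := 'I_p.+2.
Local Notation V := {ffun I -> option 'I_p.+2}.
Hypotheses (r_prime : prime p.+2) (F_neq0 : set0 \notin F).
Hypothesis f_lt : forall A, A \in F -> f A < t.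
Hypothesis no_mono : forall c (A : {ffun Z -> {set I}}), ~~ mono_family F f c A.
Implicit Types X Y : V.

Definition coloured_letters X : {set Z * 'I_t} :=
  [set q : Z * 'I_t | [exists A in F, (f A == q.2) && (A \subset letter_set X q.1)]].

Definition colour_fibre (L : {set Z * 'I_t}) c : {set Z} := [set j | (j, c) \in L].

Lemma coloured_letters_le X Y :
  vec_le X Y -> coloured_letters X \subset coloured_letters Y.
Proof.
move=> XY; apply/subsetP => q; rewrite !inE => /exists_inP[A AF /andP[fA AX]].
by apply/exists_inP; exists A; rewrite // fA (subset_trans AX) // letter_set_le.
Qed.

Lemma avoids_coloured X : avoids F X = (coloured_letters X == set0).
Proof.
apply/avoidsP/eqP => [avX|L0 j A AF].
  apply/setP => q; rewrite !inE; apply/exists_inP => -[A AF /andP[_]].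
  by apply/negP/avX.
apply/negP => AX; have : (j, Ordinal (f_lt AF)) \in coloured_letters X.
  by rewrite inE; apply/exists_inP; exists A => //=; rewrite eqxx.
by rewrite L0 inE.
Qed.

Lemma coloured_letters_rotate a X j c :
  (j + a, c)%R \in coloured_letters (rotate a X) = ((j, c) \in coloured_letters X).
Proof.
suff letterE : letter_set (rotate a X) (j + a)%R = letter_set X j.
  by rewrite !inE /= letterE.
apply/setP => i; rewrite !inE rotateE; case: (X i) => //= z.
by rewrite -[Some _ == _]/((z + a)%R == (j + a)%R) (inj_eq (addIr a)).
Qed.

Lemma colour_fibre_rotate a X c :
  colour_fibre (coloured_letters (rotate a X)) c =
  [set (j + a)%R | j in colour_fibre (coloured_letters X) c].
Proof.
apply/setP => j; rewrite -[j](subrK a) [RHS](mem_imset _ _ (addIr a)).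
rewrite ![_ \in colour_fibre _ _]inE.
exact: coloured_letters_rotate.
Qed.

(** If every sign j had a member of F of colour c inside its letter set, then
    these members, which are disjoint because letter sets are, would form a
    monochromatic edge. *)
Lemma colour_fibre_proper X c : #|colour_fibre (coloured_letters X) c| < p.+2.
Proof.
rewrite -[X in _ < X]card_ord ltn_neqAle max_card andbT.
apply/negP => full; have full_in j : (j, c) \in coloured_letters X.
  have /subset_leqif_cards[_] := subsetT (colour_fibre (coloured_letters X) c).
  rewrite cardsT full => /esym/eqP fibreT.
  by have := in_setT j; rewrite -fibreT inE.
pose fits j (A : {set I}) := [&& A \in F, f A == c & A \subset letter_set X j].
have fitsP j : exists A, fits j A.
  by have := full_in j; rewrite inE => /exists_inP[A AF fA]; exists A; rewrite /fits AF.
pose A := [ffun j => xchoose (fitsP j)].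
have AP j : fits j (A j) by rewrite ffunE; apply: xchooseP.
case/negP: (no_mono c A); apply/andP; split.
  by apply/forallP => j; case/and3P: (AP j) => -> ->.
apply/forallP => j; apply/forallP => k; apply/implyP => jk.
have [[_ _ /subsetP Aj] [_ _ /subsetP Ak]] := (and3P (AP j), and3P (AP k)).
rewrite -setI_eq0; apply/eqP/setP => i; rewrite !inE; apply/negP => /andP[/Aj + /Ak].
by rewrite !inE => /eqP -> /eqP[/eqP]; apply/negP.
Qed.

Lemma card_coloured_letters X : #|coloured_letters X| <= t * p.+1.
Proof.
have -> : #|coloured_letters X| = \sum_(c < t) #|colour_fibre (coloured_letters X) c|.
  rewrite -sum1_card; under [RHS]eq_bigr do rewrite -sum1_card.
  rewrite pair_big_dep /= (reindex (fun q : 'I_t * Z => (q.2, q.1))) /=.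
    by apply: eq_bigl => q; rewrite [RHS]inE.
  by exists (fun q => (q.2, q.1)) => -[].
rewrite -[t in leqRHS]card_ord -sum_nat_const; apply: leq_sum => c _.
exact: colour_fibre_proper.
Qed.

(** The selected colour only depends on which fibres are nonempty, and
    that is invariant under rotation; hence the choice is equivariant. *)
Definition leading_sign X : Z :=
  if [pick c | colour_fibre (coloured_letters X) c != set0] is Some c
  then mean (colour_fibre (coloured_letters X) c)
  else head ord0 (pmap X e).

Lemma leading_sign_rotate a X :
  has (isSome \o X) e -> leading_sign (rotate a X) = (leading_sign X + a)%R.
Proof.
move=> X_nz; rewrite /leading_sign.
have fibre_nz c : (colour_fibre (coloured_letters (rotate a X)) c != set0) =
    (colour_fibre (coloured_letters X) c != set0).
  by rewrite colour_fibre_rotate -!card_gt0 card_imset //; apply: addIr.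
rewrite (eq_pick fibre_nz); case: pickP => [c nz|_].
  by rewrite colour_fibre_rotate mean_shift // card_gt0 nz colour_fibre_proper.
by elim: (e) X_nz => //= i e' IH; rewrite rotateE; case: (X i).
Qed.

Lemma leading_sign_avoids X : avoids F X -> leading_sign X = head ord0 (pmap X e).
Proof.
rewrite avoids_coloured /leading_sign => /eqP ->.
by case: pickP => // c /set0Pn[j]; rewrite !inE.
Qed.

Let max_alt := \max_(X : V | avoids F X) alt_seq (map X e).

(** Vectors that avoid F come first, ordered by alternation number; max_alt
    bounds their heights, so that the others lie strictly above them. *)
Definition height X :=
  if avoids F X then alt_seq (map X e) else max_alt + #|coloured_letters X|.

(** At constant height the leading sign does not change: either the first letter
    is stable by first_letter_stable, or the coloured letters, which can only
    grow, are the same. *)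
Lemma height_lt X Y : vec_le X Y -> has (isSome \o X) e ->
  leading_sign X != leading_sign Y -> height X < height Y.
Proof.
move=> XY X_nz neq_s; rewrite /height.
have [avX|navX] := boolP (avoids F X); have [avY|navY] := boolP (avoids F Y).
- rewrite ltn_neqAle leq_alt_seq_vec // andbT.
  apply: contraNN neq_s => /eqP alt_eq; rewrite !leading_sign_avoids //.
  have := first_letter_stable XY X_nz alt_eq.
  by case: (pmap X e) => [|x ?]; case: (pmap Y e) => [|y ?] //= [->].
- have alt_le : alt_seq (map X e) <= max_alt.
    by apply: (@leq_bigmax_cond _ _ (fun X : V => alt_seq (map X e))).
  by apply: leq_ltn_trans alt_le _; rewrite -ltn_subLR // subnn card_gt0 -avoids_coloured.
- by rewrite (avoids_le XY avY) in navX.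
- rewrite ltn_add2l proper_card // properEneq coloured_letters_le // andbT.
  apply: contraNneq neq_s => eqL; rewrite /leading_sign -eqL.
  case: pickP => // fibre0; case/negP: navX; rewrite avoids_coloured -subset0.
  apply/subsetP => -[j c] jc; move/negbFE/eqP/setP/(_ j): (fibre0 c).
  by rewrite !inE in jc *; rewrite jc.
Qed.

Lemma height_gt0 X : has (isSome \o X) e -> 0 < height X.
Proof.
move=> X_nz; rewrite /height; case: ifP => [_|/negbT nav]; first exact: alt_seq_gt0.
by rewrite ltn_addl // card_gt0 -avoids_coloured.
Qed.

Lemma height_le X : height X <= max_alt + t * p.+1.
Proof.
rewrite /height; case: ifP => [av|_]; last by rewrite leq_add2l card_coloured_letters.
apply: leq_trans (leq_addr _ _).
exact: (@leq_bigmax_cond _ _ (fun X : V => alt_seq (map X e))).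
Qed.

Lemma prime_kneser_bound : uniq e -> size e <= max_alt + t * p.+1.
Proof.
move=> e_uniq; have [c [c_le c_nz c_neq]] :=
  vec_alternating_chain e_uniq leading_sign_rotate.
rewrite -(size_tuple c).
suff grow X s : path (@vec_le _ _) X s ->
    all (fun X : V => has (isSome \o X) e) (X :: s) ->
    path (fun x y => x != y) (leading_sign X) (map leading_sign s) ->
    height X + size s <= height (last X s).
  case: (tval c) c_le c_nz c_neq => //= X s s_le s_nz s_neq.
  apply: leq_trans (height_le (last X s)); apply: leq_trans (grow _ _ s_le s_nz s_neq).
  by rewrite -add1n leq_add2r; apply: height_gt0; case/andP: s_nz.
elim: s X => [|Y s IH] X /=; first by rewrite addn0.
move=> /andP[XY Ys] /and3P[X_nz Y_nz s_nz] /andP[neq_s s_neq].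
apply: leq_trans (IH Y Ys _ s_neq); last by rewrite /= Y_nz.
by rewrite addnS -addSn leq_add2r height_lt.
Qed.

Lemma prime_kneser_vec : uniq e ->
  exists X : V, [/\ avoids F X, sorted (fun x y => x != y) (pmap X e)
                  & size e <= size (pmap X e) + t * p.+1].
Proof.
move=> e_uniq.
have [|X avX maxX] :=
  @eq_bigmax_cond _ [pred X : V | avoids F X] (fun X => alt_seq (map X e)).
  by apply/card_gt0P; exists (vec0 I _); rewrite inE avoids_vec0.
have [Y [YX Y_alt Y_size]] := exists_alternating_subvec X e_uniq.
exists Y; split=> //; first exact: avoids_le YX avX.
by rewrite Y_size -maxX; apply: prime_kneser_bound.
Qed.

End PrimeCase.

(** * Composite numbers of signs *)

Section Refinement.
Variables (I S1 S2 : finType) (X : {ffun I -> option S2}).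
Variable Y : S2 -> {ffun I -> option S1}.
Implicit Types (e : seq I) (j : S2).

Definition refine : {ffun I -> option (S1 * S2)} :=
  [ffun i => if X i is Some j then omap (fun a => (a, j)) (Y j i) else None].

Definition letter_seq e j := [seq i <- e | X i == Some j].

Lemma refineE i :
  refine i = if X i is Some j then omap (fun a => (a, j)) (Y j i) else None.
Proof. exact: ffunE. Qed.

Lemma refine_head e a j : ohead (pmap refine e) = Some (a, j) ->
  ohead (pmap (Y j) (letter_seq e j)) = Some a.
Proof.
elim: e => //= i e IH; rewrite refineE; case: (X i) => [k|] //=.
rewrite -[Some k == Some j]/(k == j); case Yi: (Y k i) => [b|] /=.
  by case=> <- <-; rewrite eqxx /= Yi.
by case: eqVneq => [kj|_] //=; rewrite -[in Y j i]kj Yi.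
Qed.

(** Two neighbours of the refined vector with the same coarse sign j are also
    neighbours in Y j read along the places where X is j. *)
Lemma refine_sorted e :
  (forall j, sorted (fun x y => x != y) (pmap (Y j) (letter_seq e j))) ->
  sorted (fun x y => x != y) (pmap refine e).
Proof.
elim: e => //= i e IH alt_Y.
have {}IH : sorted (fun x y => x != y) (pmap refine e).
  apply: IH => j; move: (alt_Y j); case: ifP => //= _.
  by case: (Y j i) => //= a; apply: path_sorted.
rewrite refineE; case Xi: (X i) => [j|] //=; case Yi: (Y j i) => [a|] //=.
move: IH (@refine_head e); case: (pmap refine e) => //= -[b k] s -> head_e.
rewrite andbT; apply/negP => /eqP[ab jk].
move: (alt_Y j) (head_e _ _ erefl); rewrite Xi eqxx /= Yi /= -jk.
by case: (pmap _ _) => //= c s' /andP[/eqP ac _] [] cb; case: ac; rewrite ab.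
Qed.

Lemma sum_letter_count e (P : S2 -> pred I) :
  \sum_j count (P j) (letter_seq e j) =
  count (fun i => if X i is Some j then P j i else false) e.
Proof.
elim: e => [|i e IH] /=; first by rewrite big1.
rewrite -IH; case: (X i) => [k|]; last by rewrite add0n.
rewrite (bigD1 k) //= [in RHS](bigD1 k) //= eqxx /= -addnA; congr (_ + (_ + _)).
by apply: eq_bigr => j jk; rewrite -[Some k == Some j]/(k == j) eq_sym (negPf jk).
Qed.

Lemma size_refine e :
  size (pmap refine e) = \sum_j size (pmap (Y j) (letter_seq e j)).
Proof.
under eq_bigr do rewrite size_pmap.
rewrite size_pmap (sum_letter_count e (fun j i => isSome (Y j i))).
by apply: eq_count => i /=; rewrite refineE; case: (X i) => //= j; case: (Y j i).
Qed.

Lemma sum_size_letter_seq e : \sum_j size (letter_seq e j) = size (pmap X e).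
Proof.
under eq_bigr do rewrite -count_predT.
rewrite (sum_letter_count e (fun=> predT)) size_pmap.
by apply: eq_count => i /=; case: (X i).
Qed.

End Refinement.

Lemma mono_familyP (I S : finType) (F : {set {set I}}) f c (A : {ffun S -> {set I}}) :
  reflect [/\ forall j, A j \in F, forall j, f (A j) = c
            & forall j k, j != k -> [disjoint A j & A k]]
          (mono_family F f c A).
Proof.
apply: (iffP andP) => [[/forallP AF /forallP disj]|[AF fA disj]].
  split=> j; [by case/andP: (AF j) | by case/andP: (AF j) => _ /eqP |].
  by move=> k; apply/implyP/(forallP (disj j)).
split; apply/forallP => j; first by rewrite AF fA /=.
by apply/forallP => k; apply/implyP/disj.
Qed.

(** A set is rich in the colour c if it contains #|S1| disjoint members of F of
    colour c.  Rich sets, coloured by g, satisfy the hypothesis for S2, as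
    #|S2| disjoint rich sets of one colour contain #|S1| * #|S2| disjoint members
    of F of that colour.  In the letter set of a vector X that avoids
    rich sets, the hypothesis for S1 holds, and at most t * #|S1|.-1 places are
    lost.  Altogether at most
    t * #|S2|.-1 + #|S2| * (t * #|S1|.-1) = t * (#|S1| * #|S2|).-1
    places are lost. *)
Lemma kneser_bound_prod (S1 S2 : finType) : 0 < #|S1| -> 0 < #|S2| ->
  kneser_bound S1 -> kneser_bound S2 -> kneser_bound (S1 * S2)%type.
Proof.
move=> S1_gt0 S2_gt0 bound1 bound2 I e F f t e_uniq F0 f_lt no_mono.
have [a0 _] := card_gt0P S1_gt0.
pose rich c (N : {set I}) :=
  [exists A : {ffun S1 -> {set I}}, mono_family F f c A && [forall a, A a \subset N]].
pose G := [set N : {set I} | [exists c : 'I_t, rich c N]].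
pose g N := if [pick c : 'I_t | rich c N] is Some c then val c else 0.
have gP N : N \in G -> (g N < t) && rich (g N) N.
  rewrite inE /g; case: pickP => [c rc _|none /existsP[c]]; last by rewrite none.
  by rewrite ltn_ord.
have [X [/avoidsP avX _ size_X]] : exists X : {ffun I -> option S2},
    [/\ avoids G X, sorted (fun x y => x != y) (pmap X e)
      & size e <= size (pmap X e) + t * #|S2|.-1].
  apply: (bound2 _ _ _ g) => // [||c N]; last first.
  - apply/negP => /mono_familyP[NG gN Ndisj].
    have /fin_all_exists[A AP] j : exists A : {ffun S1 -> {set I}},
        mono_family F f c A /\ forall a, A a \subset N j.
      have /andP[_ /existsP[A /andP[mA /forallP AN]]] := gP _ (NG j).
      by exists A; rewrite -(gN j).
    case/negP: (no_mono c [ffun q => A q.2 q.1]); apply/mono_familyP; split.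
    + by move=> q; rewrite ffunE; case: (AP q.2) => /mono_familyP[].
    + by move=> q; rewrite ffunE; case: (AP q.2) => /mono_familyP[].
    + move=> [a j] [b k]; rewrite !ffunE xpair_eqE negb_and /=.
      have [<-|jk _] := eqVneq j k.
        by rewrite orbF; case: (AP j) => /mono_familyP[_ _ disj] _; apply: disj.
      by apply: disjointW (Ndisj _ _ jk); [case: (AP j) | case: (AP k)].
  - by move=> N /gP/andP[].
  - rewrite inE; apply/existsP => -[c /existsP[A /andP[/mono_familyP[AF _ _]]]].
    by move=> /forallP/(_ a0); rewrite subset0 => /eqP A0; rewrite -A0 AF in F0.
have /fin_all_exists[Y YP] j : exists Y : {ffun I -> option S1},
    [/\ avoids [set A in F | A \subset letter_set X j] Y,
        sorted (fun x y => x != y) (pmap Y (letter_seq X e j))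
      & size (letter_seq X e j) <=
        size (pmap Y (letter_seq X e j)) + t * #|S1|.-1].
  apply: (bound1 _ _ _ f) => [|||c A]; first exact: filter_uniq.
  - by rewrite inE negb_and F0.
  - by move=> A; rewrite inE => /andP[/f_lt].
  apply/negP => /mono_familyP[AF fA disj].
  have Aa a : A a \in F /\ A a \subset letter_set X j.
    by apply/andP; have := AF a; rewrite inE.
  have c_lt : c < t by rewrite -(fA a0) f_lt //; case: (Aa a0).
  have /(avX j)/negP[] // : letter_set X j \in G.
  rewrite inE; apply/existsP; exists (Ordinal c_lt); apply/existsP; exists A.
  apply/andP; split; last by apply/forallP => a; case: (Aa a).
  by apply/mono_familyP; split=> // a; case: (Aa a).
exists (refine X Y); split.
- apply/avoidsP => -[a j] A AF; apply/negP => /subsetP A_aj.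
  have A_X : A \subset letter_set X j.
    apply/subsetP => i /A_aj; rewrite !inE refineE; case: (X i) => [k|] //.
    case: (Y k i) => //= b; rewrite -[_ == _]/((b, k) == (a, j)) xpair_eqE.
    by case/andP=> _ /eqP->.
  have [/avoidsP/(_ a A)] := YP j; rewrite inE AF A_X => /(_ isT)/negP[].
  apply/subsetP => i iA; have := A_aj i iA; have := subsetP A_X i iA.
  rewrite !inE refineE => /eqP ->; case: (Y j i) => //= b.
  by rewrite -[_ == _]/((b, j) == (a, j)) xpair_eqE => /andP[/eqP->].
- by apply: refine_sorted => j; case: (YP j).
- apply: leq_trans size_X _; rewrite size_refine -sum_size_letter_seq.
  have : \sum_j size (letter_seq X e j) <=
      \sum_j (size (pmap (Y j) (letter_seq X e j)) + t * #|S1|.-1).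
    by apply: leq_sum => j _; case: (YP j).
  rewrite big_split sum_nat_const card_prod /=.
  move: S1_gt0 S2_gt0; case: #|S1| => // m1 _; case: #|S2| => // m2 _ /=.
  nia.
Qed.

Lemma card_eq_inj (S S' : finType) : #|S| = #|S'| ->
  exists g : S -> S', injective g.
Proof.
move=> eqS; exists (fun x => enum_val (cast_ord eqS (enum_rank x))).
by move=> x y /enum_val_inj/cast_ord_inj/enum_rank_inj.
Qed.

Lemma kneser_bound_card (S S' : finType) : #|S| = #|S'| ->
  kneser_bound S -> kneser_bound S'.
Proof.
move=> eqS boundS I e F f t e_uniq F0 f_lt no_mono.
have [g g_inj] := card_eq_inj eqS; have [h h_inj] := card_eq_inj (esym eqS).
have [|X [/avoidsP avX alt_X size_X]] := boundS I e F f t e_uniq F0 f_lt.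
  move=> c A; apply: contra (no_mono c [ffun x => A (h x)]).
  case/mono_familyP=> AF fA disj; apply/mono_familyP.
  split=> [j|j|j k jk]; rewrite !ffunE ?AF ?fA //.
  by apply: disj; rewrite (inj_eq h_inj).
exists [ffun i => omap g (X i)].
have pmapE : pmap [ffun i => omap g (X i)] e = map g (pmap X e).
  by elim: (e) => //= i e' IH; rewrite ffunE; case: (X i) => //= x; rewrite IH.
split.
- apply/avoidsP => j A AF; apply/negP => /subsetP Aj.
  have [i iA] : exists i, i \in A.
    by apply/set0Pn; apply: contraNneq F0 => <-.
  have := Aj i iA; rewrite inE ffunE; case Xi: (X i) => [x|] //= /eqP[gx].
  case/negP: (avX x A AF); apply/subsetP => k kA; have := Aj k kA.
  by rewrite !inE ffunE -gx; case: (X k) => //= y /eqP[/g_inj->].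
- rewrite pmapE sorted_map (eq_sorted (e' := fun x y => x != y)) // => x y.
  by rewrite /= (inj_eq g_inj).
- by rewrite pmapE size_map -eqS.
Qed.

Lemma kneser_bound_ord r : 1 < r -> kneser_bound 'I_r.
Proof.
have [m] := ubnP r; elim: m r => // m IH r lt_rm r_gt1.
have [r_prime|r_comp] := boolP (prime r).
  case: r r_prime {lt_rm r_gt1} => [|[|p]] // r_prime I e F f t e_uniq F0 f_lt no_mono.
  by rewrite card_ord; apply: prime_kneser_vec no_mono e_uniq.
have d_gt1 : 1 < pdiv r by rewrite prime_gt1 ?pdiv_prime.
have d_lt : pdiv r < r.
  rewrite ltn_neqAle pdiv_leq ?(ltnW r_gt1) // andbT.
  by apply: contraNneq r_comp => <-; apply: pdiv_prime.
have rE : r = (r %/ pdiv r) * pdiv r by rewrite divnK ?pdiv_dvd.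
have q_gt1 : 1 < r %/ pdiv r by rewrite ltn_divRL ?mul1n ?pdiv_dvd.
have q_lt : r %/ pdiv r < r by rewrite ltn_Pdiv // ltnW.
apply: (@kneser_bound_card ('I_(r %/ pdiv r) * 'I_(pdiv r))%type).
  by rewrite card_prod !card_ord -rE.
apply: kneser_bound_prod; rewrite ?card_ord ?(ltnW d_gt1) ?(ltnW q_gt1) //.
  by apply: IH => //; apply: leq_trans q_lt _.
by apply: IH => //; apply: leq_trans d_lt _.
Qed.

(** * Kneser hypergraphs *)

Lemma alt_perm_ge r n (s : 'S_n) (F : {set {set 'I_n}}) (X : signvec r n) :
  avoids F X -> sorted (fun x y => x != y) (pmap X [seq s i | i <- enum 'I_n]) ->
  size (pmap X [seq s i | i <- enum 'I_n]) <= alt_perm r s F.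
Proof.
set e := map s _ => avX alt_X.
have [X0|X_nz] := eqVneq X [ffun=> None].
  rewrite (_ : pmap X e = [::]) // X0.
  by elim: (e) => //= i e' IH; rewrite ffunE.
apply: (@leq_trans (alt s X)).
  rewrite /alt map_comp -/e -(size_map Some).
  apply: leq_alt_seq; last first.
    elim: (e) => //= i e' IH; case: (X i) => [x|] /=; first by rewrite eqxx.
    exact: subseq_trans IH (subseq_cons _ _).
  apply/andP; split; first by elim: (pmap X e).
  by rewrite sorted_map; apply: sub_sorted alt_X.
apply: (@leq_bigmax_cond _ _ (fun X => alt s X)); rewrite X_nz /=.
apply/forallP => j; apply/forall_inP => A AF; exact: (avoidsP _ _ avX).
Qed.

Lemma Kneser_lower_bound n r (hr : 1 < r) (F : {set {set 'I_n}}) (s : 'S_n) t :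
  set0 \notin F -> colorable (Kneser r F) t -> n <= alt_perm r s F + t * r.-1.
Proof.
move=> F0 /existsP[col /forall_inP col_ok].
(* Sets outside F are given colour 0; kneser_bound only looks at members of F. *)
pose f (A : {set 'I_n}) := if insub A is Some v then val (col v) else 0.
have fE (A : {set 'I_n}) (AF : A \in F) : f A = col (Sub A AF).
  by rewrite /f insubT.
pose e := [seq s i | i <- enum 'I_n].
have e_uniq : uniq e by rewrite map_inj_uniq ?enum_uniq //; apply: perm_inj.
have [||X [avX alt_X]] := @kneser_bound_ord r hr _ e F f t e_uniq F0.
- by move=> A AF; rewrite fE.
- move=> c A; apply/negP => /mono_familyP[AF fA disj].
  pose v j : Kneser_vertex F := Sub (A j) (AF j).
  have v_inj : injective v.
    move=> j k /(congr1 val) /= Ajk; apply/eqP; apply: contraT => /disj.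
    rewrite -Ajk -setI_eq0 setIid => /eqP A0.
    by rewrite -A0 AF in F0.
  have /col_ok/negP[] : v @: setT \in Kneser r F.
    rewrite inE card_imset // cardsT card_ord eqxx /=.
    apply/forall_inP => _ /imsetP[j _ ->]; apply/forall_inP => _ /imsetP[k _ ->].
    by apply/implyP => vjk; apply: disj; apply: contraNneq vjk => ->.
  apply/forall_inP => _ /imsetP[j _ ->]; apply/forall_inP => _ /imsetP[k _ ->].
  by apply/eqP/val_inj; rewrite /= -(fE _ (AF j)) -(fE _ (AF k)) !fA.
rewrite size_map size_enum_ord card_ord => size_e.
by apply: leq_trans size_e _; rewrite leq_add2r alt_perm_ge.
Qed.

Theorem theorem1 (n r : nat) (hn : 1 <= n) (hr : 2 <= r)
    (F : {set {set 'I_n}}) (hF : set0 \notin F) :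
  (((n%:R - (alt_min r F)%:R) / (r%:R - 1) : rat)
    <= (chromatic_number (Kneser r F))%:R)%R.
Proof.
have col := chromatic_number_colorable (Kneser_colorable F hr).
have := Kneser_lower_bound hr [arg min_(s < (1%g : 'S_n)) alt_perm r s F] hF col.
rewrite -/(alt_min r F) -(ler_nat rat) natrD natrM => bound.
have r1_gt0 : (0 < r.-1%:R :> rat)%R by rewrite ltr0n; case: r hr {col bound} => [|[]].
have -> : (r%:R - 1 = r.-1%:R :> rat)%R by rewrite -subn1 natrB // ltnW.
by rewrite ler_pdivrMr // lerBlDl.
Qed.
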